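(* Let $\Sigma=\{a,b\}$, let $n$ be a positive integer, and let $L=\Sigma^{*}a^{n-1}b\,\Sigma^{*}$. Then there exist two different (non-isomorphic) strongly connected synchronizing deterministic finite automata $\mathscr{A}$ and $\mathscr{B}$ over $\Sigma$, each with exactly $n+1$ states, such that $\mathrm{Syn}(\mathscr{A})=\mathrm{Syn}(\mathscr{B})=L$; moreover $n+1=rc(L)$, so that both automata have the minimal possible number of states among all synchronizing automata whose language of synchronizing words is $L$.
   Context: A deterministic finite automaton (DFA) here is a triple $\mathscr{A}=\langle Q,\Sigma,\delta\rangle$ with finite nonempty state set $Q$, finite input alphabet $\Sigma$ and a total transition function $\delta:Q\times\Sigma\to Q$, extended to $Q\times\Sigma^{*}\to Q$ in the natural way (no initial or final states). It is synchronizing if there is a word $w\in\Sigma^{*}$ with $\delta(q,w)=\delta(q',w)$ for all $q,q'\in Q$; such a $w$ is called a synchronizing word, and $\mathrm{Syn}(\mathscr{A})$ denotes the set of all synchronizing words of $\mathscr{A}$. The automaton is strongly connected if for any two distinct states $p,q$ there is a word $u$ with $\delta(p,u)=q$. Two automata over the same alphabet $\Sigma$ are isomorphic if there is a bijection between their state sets commuting with the action of every letter of $\Sigma$. A language $L\subseteq\Sigma^{*}$ is ideal if $L=\Sigma^{*}L\Sigma^{*}$. The reset complexity $rc(L)$ of a regular ideal language $L$ is the minimal possible number of states in a synchronizing automaton $\mathscr{A}$ over $\Sigma$ with $\mathrm{Syn}(\mathscr{A})=L$. The equality $rc(\Sigma^{*}a^{n-1}b\,\Sigma^{*})=n+1$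 is known from earlier work (M. Maslennikova, Reset Complexity of Ideal Languages, SOFSEM 2012).
   Formalization: Non-isomorphism of the two automata is claimed only for n ≥ 2: for n = 1, a must permute the two states, b is constant, and strong connectivity forces a to swap them, so the automaton is unique up to isomorphism; all other claims are kept for every n ≥ 1. *)

(* Defs.v *)
From mathcomp Require Import all_boot.
Set Implicit Arguments.
Unset Strict Implicit.
Unset Printing Implicit Defensive.

Record dfa (char : finType) := Dfa {
  state :> finType;
  state_gt0 : 0 < #|state|;
  step : state -> char -> state
}.

Section Automata.
Variable char : finType.
Implicit Types (A B : dfa char) (u v w : seq char).

Definition language := seq char -> Prop.

Definition same_language (K L : language) := forall w, K w <-> L w.

Definition run A (q : A) w : A := foldl (@step char A) q w.

Definition Syn A : language := fun w => forall p q : A, run p w = run q w.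

Definition synchronizing A := exists w, Syn A w.

Definition strongly_connected A :=
  forall p q : A, p <> q -> exists u, run p u = q.

Definition isomorphic A B :=
  exists2 f : A -> B, bijective f &
    forall (q : A) (c : char), f (step q c) = step (f q) c.

(* The ideal generated by a single word x, that is, the language of all words
   having x as a factor. *)
Definition principal_ideal (x : seq char) : language :=
  fun w => exists u v, w = u ++ x ++ v.

Definition recognizes_by_sync A (L : language) :=
  synchronizing A /\ same_language (Syn A) L.

(* [is_rc L m] states rc(L) = m; as a relation, it needs no default value for
   languages that are not regular ideals. *)
Definition is_rc (L : language) (m : nat) :=
  (exists2 A : dfa char, recognizes_by_sync A L & #|A| = m) /\
  (forall A : dfa char, recognizes_by_sync A L -> m <= #|A|).

End Automata.

Definition letter : finType := bool.
Definition letter_a : letter := false.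
Definition letter_b : letter := true.

(* The language of all words with a factor a^(n-1) b, for n > 0. *)
Definition Lan (n : nat) : language letter :=
  principal_ideal (rcons (nseq n.-1 letter_a) letter_b).

(* Main.v *)
Require Import Defs.
From mathcomp Require Import all_boot.

(** Write x = a^m b with m = n - 1. In an automaton with Syn = L the images
    Q, Q.a, ..., Q.a^m strictly decrease (if Q.a^k = Q.a^(k+1) with k < m, then
    Q.a^k = Q.a^m and already a^k b is synchronizing), and the last one is not a
    singleton; hence there are at least m + 2 states.

    In the extremal case the letter a acts as a path of m states leading into a
    two-element set E that a permutes, and b collapses E. Both permutations of E
    can be realized: let b send E to the start o of the path, and each path state
    to one and the same h in E, chosen so that o.a^m <> h.a^m. A word a^j b with
    j < m swaps o and h, so a word avoiding x never merges these two states.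
    The two automata differ in whether a has a fixed point. *)

Set Implicit Arguments.
Unset Strict Implicit.
Unset Printing Implicit Defensive.

Lemma run_cat (char : finType) (A : dfa char) (q : A) u v :
  run q (u ++ v) = run (run q u) v.
Proof. exact: foldl_cat. Qed.

Lemma run_rcons (char : finType) (A : dfa char) (q : A) u c :
  run q (rcons u c) = step (run q u) c.
Proof. by rewrite -cats1 run_cat. Qed.

Lemma Syn_factor (char : finType) (A : dfa char) u w v :
  Syn A w -> Syn A (u ++ w ++ v).
Proof. by move=> sw p q; rewrite !run_cat (sw _ (run q u)). Qed.

Lemma nseqSr (T : Type) k (x : T) : nseq k.+1 x = rcons (nseq k x) x.
Proof. by rewrite -addn1 nseqD cats1. Qed.

Section LowerBound.

Variables (char : finType) (A : dfa char) (a : char).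

Definition power_image k : {set A} := [set run q (nseq k a) | q : A].

Lemma power_imageS k :
  power_image k.+1 = [set step q a | q in power_image k].
Proof.
rewrite /power_image -imset_comp; apply: eq_imset => q /=.
by rewrite -run_rcons -nseqSr.
Qed.

Lemma power_imageS_sub k : power_image k.+1 \subset power_image k.
Proof. by apply/subsetP => _ /imsetP[q _ ->]; apply: (imset_f (fun p => _)). Qed.

Lemma power_image_stable k d :
  power_image k.+1 = power_image k -> power_image (k + d) = power_image k.
Proof.
by move=> eqk; elim: d => [|d IH]; rewrite ?addn0 // addnS power_imageS IH -power_imageS.
Qed.

(** Being synchronizing for [a^k b] means that [b] is constant on the image under [a^k], so only
    that image matters. *)
Lemma Syn_power_image k l b :
  power_image l = power_image k ->
  Syn A (rcons (nseq l a) b) -> Syn A (rcons (nseq k a) b).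
Proof.
move=> eqI sl p q; rewrite !run_rcons.
have im r : run r (nseq k a) \in power_image l by rewrite eqI; apply: imset_f.
have /imsetP[p' _ ->] := im p; have /imsetP[q' _ ->] := im q.
by rewrite -!run_rcons; apply: sl.
Qed.

Lemma card_power_image m b :
  Syn A (rcons (nseq m a) b) ->
  (forall k, k < m -> ~ Syn A (rcons (nseq k a) b)) ->
  #|power_image m| + m <= #|A|.
Proof.
move=> sm nsk; suff: forall k, k <= m -> #|power_image k| + k <= #|A| by apply.
elim=> [|k IH] ltkm; first by rewrite addn0 max_card.
apply: leq_trans (IH (ltnW ltkm)); rewrite addnS -addSn leq_add2r.
apply: proper_card; rewrite properEneq power_imageS_sub andbT.
apply/eqP => /(@power_image_stable _ (m - k)); rewrite subnKC ?(ltnW ltkm) // => eqI.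
exact: nsk ltkm (Syn_power_image eqI sm).
Qed.

Lemma card_power_image_gt1 k : ~ Syn A (nseq k a) -> 1 < #|power_image k|.
Proof.
move=> nsk; rewrite ltnNge; apply/negP => /card_le1_eqP le1.
by case: nsk => p q; apply: le1; apply: imset_f.
Qed.

End LowerBound.

Lemma rc_lower_bound m (A : dfa letter) :
  same_language (Syn A) (Lan m.+1) -> m.+2 <= #|A|.
Proof.
move=> synA; have sm : Syn A (rcons (nseq m letter_a) letter_b).
  by apply/synA; exists [::], [::]; rewrite cats0.
rewrite -addn2 addnC; apply: leq_trans (card_power_image sm _).
  (* [a^m] contains no [b], and for [k < m] the word [a^k b] has too few [a]'s; neither can have
     [a^m b] as a factor. *)
  rewrite leq_add2r; apply: card_power_image_gt1 => /synA[u [v]].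
  move/(congr1 (count_mem letter_b)).
  by rewrite !count_cat -cats1 count_cat !count_nseq /= !mul0n add0n addnC.
move=> k ltkm /synA[u [v]] /(congr1 (count_mem letter_a)).
rewrite !count_cat -!cats1 !count_cat !count_nseq /= !mul1n !addn0 => eqk.
by move: ltkm; rewrite eqk ltnNge addnCA leq_addr.
Qed.

Section PathAutomaton.

(* [inl] marks the path, [inr] the two-element set; the letter a swaps the latter
   iff [twist]. *)
Variables (m : nat) (twist : bool).

Definition path_state : finType := ('I_m + bool)%type.

(* The path runs into [inr false] at k = m; values at k > m are junk. *)
Definition path_at k : path_state :=
  if insub k is Some i then inl i else inr false.

(** The sign is chosen so that [a^m] takes this state to [inr true], whereas it takes [path_at 0] to
    [inr false]. *)
Definition exit_state : path_state := inr (~~ (twist && odd m)).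

Definition path_step (q : path_state) (c : letter) : path_state :=
  match q, c with
  | inl i, false => path_at i.+1
  | inl _, true => exit_state
  | inr e, false => inr (e (+) twist)
  | inr _, true => path_at 0
  end.

Lemma card_path_state : #|path_state| = m.+2.
Proof. by rewrite card_sum card_ord card_bool addn2. Qed.

Lemma path_state_gt0 : 0 < #|path_state|.
Proof. by rewrite card_path_state. Qed.

Definition path_dfa : dfa letter := Dfa path_state_gt0 path_step.

Lemma path_at_lt k (ltkm : k < m) : path_at k = inl (Ordinal ltkm).
Proof. by rewrite /path_at insubT. Qed.

Lemma path_at_ge k : m <= k -> path_at k = inr false.
Proof. by move=> lemk; rewrite /path_at insubF // ltnNge lemk. Qed.

Lemma path_at_ord (i : 'I_m) : path_at i = inl i.
Proof. by rewrite /path_at valK. Qed.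

Lemma run_inr_a e k :
  run (inr e : path_dfa) (nseq k letter_a) = inr (e (+) (twist && odd k)).
Proof.
elim: k => [|k IH]; first by rewrite andbF addbF.
by rewrite nseqSr run_rcons {}IH /=; case: twist (odd k) e => [] [] [].
Qed.

Lemma run_path_a k :
  run (path_at 0 : path_dfa) (nseq k letter_a) =
  if k < m then path_at k else inr (twist && odd (k - m)).
Proof.
(* The bound includes [j = m], the entry into the two-element set, from which the other [k - m]
   letters are read. *)
have short j : j <= m -> run (path_at 0 : path_dfa) (nseq j letter_a) = path_at j.
  elim: j => // j IH ltjm; rewrite nseqSr run_rcons IH ?(ltnW ltjm) //=.
  by rewrite (path_at_lt ltjm).
case: ltnP => [/ltnW/short // | lemk].
rewrite -{1}(subnKC lemk) nseqD run_cat short // path_at_ge //.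
by rewrite run_inr_a.
Qed.

Lemma run_power_a_inr (q : path_dfa) :
  exists e, run q (nseq m letter_a) = inr e.
Proof.
case: q => [i|e]; last by rewrite run_inr_a; eexists.
(* State [i] is reached from the start by [a^i], so [a^(i + m)] from the start runs past the
   path. *)
rewrite -path_at_ord; have := run_path_a i; rewrite ltn_ord => <-.
rewrite -run_cat -nseqD run_path_a ltnNge leq_addl /=.
by eexists.
Qed.

Lemma Syn_path_dfa_power : Syn path_dfa (rcons (nseq m letter_a) letter_b).
Proof.
move=> p q; rewrite !run_rcons.
by have [e ->] := run_power_a_inr p; have [f ->] := run_power_a_inr q.
Qed.

Lemma run_path_exit_neq k :
  run (path_at 0 : path_dfa) (nseq k letter_a)
    != run (exit_state : path_dfa) (nseq k letter_a).
Proof.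
rewrite run_path_a run_inr_a; case: ltnP => [ltkm | lemk].
  by rewrite (path_at_lt ltkm).
rewrite (inj_eq inr_inj) oddB //.
by case: twist (odd k) (odd m) => [] [] [].
Qed.

(** Induction on [w] from the right: a letter [a] lengthens the trailing block; a letter [b] can
    follow only if [j < m], and then it exchanges [o] and [h] and resets [j] to 0. *)
Lemma run_avoiding w :
  ~~ infix (rcons (nseq m letter_a) letter_b) w ->
  let o : path_dfa := path_at 0 in let h : path_dfa := exit_state in
  exists j u, w = u ++ nseq j letter_a /\
    let oj := run o (nseq j letter_a) in let hj := run h (nseq j letter_a) in
    (run o w, run h w) = (oj, hj) \/ (run o w, run h w) = (hj, oj).
Proof.
move=> /[swap] o /[swap] h.
elim/last_ind: w => [_|w c IH avoid]; first by exists 0, [::]; split; last left.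
have [|j [u [def_w IHw]]] := IH.
  by apply: contra avoid => inf; rewrite infix_rconsl inf orbT.
case: c avoid => avoid; last first.
  exists j.+1, u; split; first by rewrite def_w nseqSr rcons_cat.
  by rewrite !nseqSr !run_rcons; case: IHw => [] [-> ->]; [left | right].
exists 0, (rcons w true); rewrite cats0; split=> //.
have ltjm : j < m.
  rewrite ltnNge; apply: contra avoid => lemj; apply/infixP.
  exists (u ++ nseq (j - m) letter_a), [::].
  by rewrite def_w -{1}(subnK lemj) nseqD cats0 catA rcons_cat.
have oj : step (run o (nseq j letter_a)) true = h.
  by rewrite /o run_path_a ltjm (path_at_lt ltjm).
have hj : step (run h (nseq j letter_a)) true = o by rewrite /h run_inr_a.
by rewrite !run_rcons; case: IHw => [] [-> ->]; rewrite oj hj; [right | left].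
Qed.

Lemma Syn_path_dfa : same_language (Syn path_dfa) (Lan m.+1).
Proof.
move=> w; split=> [sw | [u [v ->]]]; last exact: Syn_factor Syn_path_dfa_power.
apply/infixP; apply: contraT => /run_avoiding[j [_ [_ eqw]]].
have := run_path_exit_neq j; have := sw (path_at 0) exit_state.
by case: eqw => [] [-> ->] ->; rewrite eqxx.
Qed.

Lemma synchronizing_path_dfa : synchronizing path_dfa.
Proof. by eexists; apply: Syn_path_dfa_power. Qed.

(* Without the twist and with an empty path, a fixes both states. *)
Lemma strongly_connected_path_dfa :
  twist || (0 < m) -> strongly_connected path_dfa.
Proof.
move=> nontriv p q _.
have [u pu] : exists u, run p u = path_at 0.
  by case: p => [i|e]; [exists [:: true; true] | exists [:: true]].
suff [v qv] : exists v, run (path_at 0 : path_dfa) v = q.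
  by exists (u ++ v); rewrite run_cat pu.
case: q => [i|[]].
- by exists (nseq i letter_a); rewrite run_path_a ltn_ord path_at_ord.
(* With the twist, one more [a] after entering at [inr false] reaches [inr true]; without it,
   [inr true] is the exit state, one [b] away from the path. *)
- case: (boolP twist) => [tw | /negbTE ntw].
    by exists (nseq m.+1 letter_a); rewrite run_path_a ltnNge leqnSn subSnn tw.
  move: nontriv; rewrite ntw /= => m_gt0; exists [:: true].
  by rewrite (path_at_lt m_gt0) /= /exit_state ntw.
- by exists (nseq m letter_a); rewrite run_path_a ltnn subnn andbF.
Qed.

Lemma path_dfa_fixpoint_a : (exists q : path_dfa, step q letter_a = q) <-> ~~ twist.
Proof.
split=> [[[i|e]] /= | /negbTE ntw]; last by exists (inr false); rewrite /= ntw.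
  rewrite /path_at; case: insubP => // j _ eqj [] /(congr1 val)/eqP.
  by rewrite eqj eqn_leq ltnn.
by case=> /eqP; case: twist e => [] [].
Qed.

End PathAutomaton.

(* Non-isomorphism is asserted for n > 1 only, since it fails for n = 1: there
   a must permute the two states and b must be constant, so strong connectivity
   forces a to swap the states, and the automaton is unique up to isomorphism. *)
Theorem mainTheorem1 (n : nat) (n_gt0 : 0 < n) :
  (exists A B : dfa letter,
     [/\ strongly_connected A /\ strongly_connected B,
         synchronizing A /\ synchronizing B,
         #|A| = n.+1 /\ #|B| = n.+1,
         same_language (Syn A) (Lan n) /\ same_language (Syn B) (Lan n)
       & 1 < n -> ~ isomorphic A B]) /\
  is_rc (Lan n) n.+1.
Proof.
case: n n_gt0 => // m _; split; last first.
  split=> [|A [_ /rc_lower_bound //]].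
  exists (path_dfa m true); last exact: card_path_state.
  by split; [apply: synchronizing_path_dfa | apply: Syn_path_dfa].
(* For [m > 0] the first automaton is untwisted; for [m = 0] that one would not be strongly
   connected, so the twisted one is taken twice. *)
exists (path_dfa m (m == 0)), (path_dfa m true); split.
- by split; apply: strongly_connected_path_dfa => //; case: (m).
- by split; apply: synchronizing_path_dfa.
- by split; apply: card_path_state.
- by split; apply: Syn_path_dfa.
rewrite ltnS lt0n => m_neq0 [f _ f_step].
have [q fix_q] := (path_dfa_fixpoint_a m (m == 0)).2 m_neq0.
have /(path_dfa_fixpoint_a m true).1 // : exists q : path_dfa m true, step q letter_a = q.
by exists (f q); rewrite -f_step fix_q.
Qed.
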